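(* Every planar graph with at least one vertex containing no subgraph isomorphic to $K_4$, $C_5$, $C_6$ or $C_7$ contains at least one of the configurations (D1)–(D12): (D1) a vertex of degree at most $2$. (D2) a triangle $T(3,3,3)$ or $T(3,3,4)$. (D3) two diamonds $D_1=\mathrm{Dia}(6-3,4,3)$ and $D_2=\mathrm{Dia}(6-3,4,4)$ sharing their middle $6$-vertex and no other vertex. (D4) $\mathrm{Dia}(3-3,4^+,4^+)$. (D5) $\mathrm{Dia}(4-5,3,3)$. (D6) $\mathrm{Dia}(4-3,4,4)$. (D7) $\mathrm{Dia}(5-3,4,4)$ together with a $3$-vertex outside it adjacent to its middle $5$-vertex. (D8) $\mathrm{Dia}(5-5,3,3)$ together with a $3$-vertex outside it adjacent to one of its middle $5$-vertices. (D9) three $3$-vertices $u,v,w$ with $uv,vw\in E(G)$ and $uw\notin E(G)$. (D10) $\mathrm{Dia}(5-3,4,3)$. (D11) a triangle $T(5,3,3)$ together with a $3$-vertex outside it adjacent to its $5$-vertex. (D12) two triangles $T(6,3,3)$ sharing their $6$-vertex and no other vertex.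
   Context: All degrees are degrees in $G$; a $d$-vertex ($d^+$-vertex) is a vertex of degree exactly $d$ (at least $d$). $T(a,b,c)$ denotes a triangle whose vertices have degrees $a,b,c$. A diamond is a subgraph isomorphic to $K_4$ minus an edge; its two vertices of degree $3$ in it are middle vertices, the other two are side vertices. $\mathrm{Dia}(a-b,c,d)$ denotes a diamond whose middle vertices have degrees $a,b$ and whose side vertices have degrees $c,d$; an entry $s^+$ means degree at least $s$. ''$G$ contains a configuration'' means $G$ has vertices with the described adjacencies, non-adjacencies and degrees. *)

(* Defs.v *)
(* Finite simple graphs as symmetric irreflexive relations
   on a finType; planarity via rotation systems (combinatorial embeddings). *)
From mathcomp Require Import all_boot fingroup perm.
Set Implicit Arguments. Unset Strict Implicit. Unset Printing Implicit Defensive.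

Section Graphs.
Variables (T : finType) (e : rel T).

Definition simple_graph := symmetric e /\ irreflexive e.

Definition deg (x : T) : nat := #|[set y | e x y]|.

Definition dart := {p : T * T | e p.1 p.2}.
Definition dsrc (d : dart) : T := (val d).1.
(* reversal of a dart (well defined since e is symmetric) *)
Definition drev (d : dart) : dart :=
  odflt d (insub ((val d).2, (val d).1)).

(* a rotation system: at every vertex, a cyclic order of the darts leaving it *)
Definition rotation (rho : {perm dart}) : Prop :=
  (forall d, dsrc (rho d) = dsrc d) /\
  (forall d d', dsrc d = dsrc d' -> fconnect rho d d').

Definition face_perm (rho : {perm dart}) (d : dart) : dart := rho (drev d).

Definition isolated (x : T) : bool := deg x == 0.

(* Euler / Heffter-Edmonds criterion: the embedding given by rho has genus 0
   on each component, i.e.  V - E + F = 2 C - I  where C = #components,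
   I = #isolated vertices (isolated vertices carry no darts), E = #darts / 2. *)
Definition planar : Prop :=
  exists rho : {perm dart}, rotation rho /\
    2 * #|T| + 2 * fcard (face_perm rho) predT + 2 * #|[pred x | isolated x]|
    = 4 * n_comp e predT + #|{: dart}|.

Definition has_K4 : Prop :=
  exists a b c d : T, [&& e a b, e a c, e a d, e b c, e b d & e c d].
Definition has_cycle (k : nat) : Prop :=
  exists s : seq T, [/\ size s = k, uniq s & path.cycle e s].

Definition tri (x y z : T) : bool := [&& e x y, e y z & e x z].
Definition diamond (m1 m2 s1 s2 : T) : bool :=
  [&& e m1 m2, e m1 s1, e m2 s1, e m1 s2, e m2 s2 & s1 != s2].
Definition dia_cfg (P1 P2 Q1 Q2 : pred nat) (m1 m2 s1 s2 : T) : bool :=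
  diamond m1 m2 s1 s2 && [&& P1 (deg m1), P2 (deg m2), Q1 (deg s1) & Q2 (deg s2)].
Definition has_dia (P1 P2 Q1 Q2 : pred nat) : Prop :=
  exists m1 m2 s1 s2, dia_cfg P1 P2 Q1 Q2 m1 m2 s1 s2.

Definition D1 := exists v, deg v <= 2.
Definition D2 := exists x y z, tri x y z &&
   [&& deg x == 3, deg y == 3 & (deg z == 3) || (deg z == 4)].
Definition D3 := exists m a s1 s2 b t1 t2,
   [&& dia_cfg (pred1 6) (pred1 3) (pred1 4) (pred1 3) m a s1 s2,
       dia_cfg (pred1 6) (pred1 3) (pred1 4) (pred1 4) m b t1 t2 &
       uniq [:: m; a; s1; s2; b; t1; t2]].
Definition D4 := has_dia (pred1 3) (pred1 3) (fun n => 4 <= n) (fun n => 4 <= n).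
Definition D5 := has_dia (pred1 4) (pred1 5) (pred1 3) (pred1 3).
Definition D6 := has_dia (pred1 4) (pred1 3) (pred1 4) (pred1 4).
Definition D7 := exists m1 m2 s1 s2 w,
   [&& dia_cfg (pred1 5) (pred1 3) (pred1 4) (pred1 4) m1 m2 s1 s2,
       deg w == 3, e w m1 & w \notin [:: m1; m2; s1; s2]].
Definition D8 := exists m1 m2 s1 s2 w,
   [&& dia_cfg (pred1 5) (pred1 5) (pred1 3) (pred1 3) m1 m2 s1 s2,
       deg w == 3, e w m1 & w \notin [:: m1; m2; s1; s2]].
Definition D9 := exists u v w,
   [&& deg u == 3, deg v == 3, deg w == 3, e u v, e v w, ~~ e u w & u != w].
Definition D10 := has_dia (pred1 5) (pred1 3) (pred1 4) (pred1 3).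
Definition D11 := exists x y z w,
   [&& tri x y z, deg x == 5, deg y == 3, deg z == 3, deg w == 3, e w x &
       w \notin [:: x; y; z]].
Definition D12 := exists x a b c d,
   [&& tri x a b, tri x c d, deg x == 6, deg a == 3, deg b == 3, deg c == 3,
       deg d == 3 & uniq [:: x; a; b; c; d]].

End Graphs.

(* Main.v *)
Require Import Defs.
From Stdlib Require Import Classical.
From mathcomp Require Import all_boot fingroup perm zify.
Set Implicit Arguments. Unset Strict Implicit. Unset Printing Implicit Defensive.

(* Discharging. Assume minimum degree 3 and none of the configurations.  Give every
   corner of a face of length l the charge 48 / l and every vertex v the charge
   48 - 24 deg v; by Euler's formula the total is positive.  Since there are no
   K4, C5 and C6, triangular faces are isolated or paired into diamonds, 4-faces
   meet neither triangles nor each other along an edge, and there are no 5-faces.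
   Faces of length at least 8 put at most 6 on each corner.  A facial walk of
   length 6 or 7 is not a cycle: it runs through two closed walks of lengths 3
   and 3, or 3 and 4, glued at a vertex; its surplus over 6 per corner is charged
   to the two corners at that vertex, which therefore weigh 12 or 9.

   Only 3-vertices on triangular faces are then positive: +4 on one triangle, +14
   in the middle of a diamond.  Vertices of higher degree pay for them, each
   through the triangles and diamonds it lies on: the absence of D2, D4 and D6
   balances every triangle and diamond.  No vertex overspends: up to degree 7
   this is a finite check on the cyclic sequence of its corner types, whose only
   exceptions, a 5-vertex on a diamond and a further triangle and a 6-vertex in
   the middle of two diamonds, are excluded by D3, D7 and D9-D12; from degree 8
   on the corners cost at most 18 each on average.  Hence the total is not
   positive, a contradiction. *)

(** * Cyclic sequences of corner kinds and their cost *)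

(* The face at a corner: a triangle, a 4-cycle, a glued walk of length 6 or 7 whose
   gluing vertex is the corner, or any other face. *)
Inductive kind := Tri | Quad | Glued | Big.

Definition is_tri k := if k is Tri then true else false.
Definition is_glued k := if k is Glued then true else false.
Definition is_big k := if k is Big then true else false.

Definition pair_ok a b :=
  match a, b with Tri, Quad | Quad, Tri | Quad, Quad => false | _, _ => true end.

Definition triple_ok a b c :=
  (is_tri a && is_tri b ==> is_big c) && (is_tri b && is_tri c ==> is_big a).

Definition quintuple_ok a b c d f :=
  ~~ [&& is_glued a, is_tri b, is_glued c, is_tri d & is_glued f].

(** A triangular corner starts from 16. A 3-vertex receives 4, or 14 in the middle of a diamond; a
    4-vertex pays 2 or 4, and a vertex of higher degree at most 8 or 16. *)
Definition single_cost n := if n == 3 then 12 else if n == 4 then 18 else 24.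
Definition spine_cost n := if n == 3 then 2 else if n == 4 then 20 else 32.

(* Bound on the cost of the corner [c] at a vertex of degree [n], from the kinds
   of the two corners before it and the two after it. *)
Definition corner_cost n a b c d f :=
  match c with
  | Tri => if is_tri d then spine_cost n else if is_tri b then 16 else single_cost n
  | Quad => 12
  | Glued => if is_tri d && is_glued f || is_glued a && is_tri b then 9 else 12
  | Big => 6
  end.

Section CyclicKinds.
Variables (n : nat) (K : nat -> kind).

Definition window P :=
  all (fun i => P (K i) (K i.+1) (K i.+2) (K i.+3) (K i.+4) : bool) (iota 0 n).

(** The last conjunct records that the second glued corner of the same walk lies at the same vertex
    and is not a neighbouring corner, so its offset runs from 2 to [n - 2]. *)
Definition kinds_ok :=
  [&& window (fun a b _ _ _ => pair_ok a b),
      window (fun a b c _ _ => triple_ok a b c),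
      window quintuple_ok
    & all (fun i => is_glued (K i) ==>
             has (fun j => is_glued (K (i + j))) (iota 2 (n - 3))) (iota 0 n)].

Definition kinds_cost :=
  sumn [seq corner_cost n (K i) (K i.+1) (K i.+2) (K i.+3) (K i.+4) | i <- iota 0 n].

(** The patterns of [heavy5] and [heavy6] can cost 84 and 108 against the allowed 72 and 96;
    excluding them takes the degrees of the neighbours, which the kinds do not show. *)
Definition heavy5 :=
  (n == 5) && has (fun i => [&& is_tri (K i), is_tri (K i.+1), is_big (K i.+2),
                       is_tri (K i.+3) & is_big (K i.+4)]) (iota 0 n).

Definition heavy6 :=
  (n == 6) && has (fun i => [&& is_tri (K i), is_tri (K i.+1), is_big (K i.+2),
      is_tri (K i.+3), is_tri (K i.+4) & is_big (K i.+4.+1)]) (iota 0 n).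

End CyclicKinds.

Definition cyc s i := nth Big s (i %% size s).

Fixpoint all_kinds n (P : seq kind -> bool) : bool :=
  if n is m.+1 then
    [&& all_kinds m (fun s => P (Tri :: s)), all_kinds m (fun s => P (Quad :: s)),
        all_kinds m (fun s => P (Glued :: s)) & all_kinds m (fun s => P (Big :: s))]
  else P [::].

Lemma all_kindsP n P s : all_kinds n P -> size s = n -> P s.
Proof.
elim: n P s => [|n IH] P [|k s] //= /and4P [hT hQ hG hB] [] sz.
by case: k; [move: hT | move: hQ | move: hG | move: hB] => /IH; apply.
Qed.

(** Exhaustive evaluation for the degrees 3 to 7, at most [4 ^ 7] words per degree. *)
Lemma kinds_cost_table : all (fun n => all_kinds n (fun s =>
    let K := cyc s in
    kinds_ok n K ==> [|| kinds_cost n K <= 24 * n - 48, heavy5 n K | heavy6 n K]))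
  (iota 3 5).
Proof. by vm_compute. Qed.

Lemma kinds_costE n K : kinds_cost n K =
  \sum_(0 <= i < n) corner_cost n (K i) (K i.+1) (K i.+2) (K i.+3) (K i.+4).
Proof. by rewrite /kinds_cost sumnE big_map /index_iota subn0. Qed.

(* Amortisation: a run of triangles borrows from the corner that follows it. *)
Definition carry a b c :=
  if is_tri b then if is_tri c then 14 else if is_tri a then 12 else 6 else 0.

Lemma corner_cost_carry n a b c d f : 4 < n -> triple_ok a b c -> triple_ok b c d ->
  corner_cost n a b c d f + carry a b c <= 18 + carry b c d.
Proof.
case: n => [|[|[|[|[|n]]]]] // _.
by case: a => //; case: b => //; case: c => //; case: d => //; case: f.
Qed.

(** The carries telescope and cancel after one turn around the vertex, which leaves at most 18 per
    corner; [18 * n <= 24 * n - 48] starts at [n = 8]. *)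
Lemma kinds_cost_large n K : 7 < n -> (forall i, K (n + i) = K i) ->
  kinds_ok n K -> kinds_cost n K <= 24 * n - 48.
Proof.
move=> n8 per /and4P [_ /allP tr _ _]; have n0 : 0 < n by lia.
(* [window] only tests starting positions below [n]; periodicity extends the condition to all of
   them. *)
have trK i : triple_ok (K i) (K i.+1) (K i.+2).
  move: (divn_eq i n) (ltn_pmod i n0); move: (i %/ n) (i %% n) => q r -> ltr.
  elim: q => [|m IH]; first by rewrite mul0n; apply: tr; rewrite mem_iota.
  by move: IH; rewrite mulSn -addnA -!addnS !per.
pose G i := carry (K i) (K i.+1) (K i.+2).
have tele m : \sum_(0 <= i < m) corner_cost n (K i) (K i.+1) (K i.+2) (K i.+3) (K i.+4)
    + G 0 <= 18 * m + G m.
  elim: m => [|m IH]; first by rewrite big_geq.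
  have n5 : 4 < n by lia.
  have := corner_cost_carry (K m.+4) n5 (trK m) (trK m.+1).
  by rewrite big_nat_recr //= -/(G m) -/(G m.+1); lia.
have Gn : G n = G 0 by rewrite /G -(per 0) -(per 1) -(per 2) addn0 addn1 addn2.
by have := tele n; rewrite -kinds_costE Gn; lia.
Qed.

Lemma kinds_cost_small n K : 2 < n < 8 -> (forall i, K (n + i) = K i) ->
  kinds_ok n K -> [\/ kinds_cost n K <= 24 * n - 48, heavy5 n K | heavy6 n K].
Proof.
move=> n38 per; pose s := [seq K i | i <- iota 0 n].
have sz : size s = n by rewrite size_map size_iota.
have n0 : 0 < n by case: n n38 {per s sz}.
have cK : cyc s =1 K.
  move=> i; rewrite /cyc sz (nth_map 0) ?size_iota ?ltn_pmod // nth_iota ?ltn_pmod //.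
  rewrite add0n {2}(divn_eq i n); elim: (i %/ n) => [|m IH]; first by rewrite mul0n.
  by rewrite mulSn -addnA per.
have /allP/(_ n) := kinds_cost_table; rewrite mem_iota => /(_ n38) /all_kindsP /(_ sz) /=.
have ewin P : window n (cyc s) P = window n K P.
  by apply: eq_all => i; rewrite !cK.
have -> : kinds_ok n (cyc s) = kinds_ok n K.
  rewrite /kinds_ok !ewin; congr [&& _, _, _ & _]; apply: eq_all => i.
  by rewrite cK; congr (_ ==> _); apply: eq_has => j; rewrite cK.
have -> : kinds_cost n (cyc s) = kinds_cost n K.
  by congr sumn; apply: eq_map => i; rewrite !cK.
have -> : heavy5 n (cyc s) = heavy5 n K.
  by congr andb; apply: eq_has => i; rewrite !cK.
have -> : heavy6 n (cyc s) = heavy6 n K.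
  by congr andb; apply: eq_has => i; rewrite !cK.
by move=> + ok => /implyP /(_ ok) /or3P.
Qed.

Lemma kinds_cost_bound n K : 2 < n -> (forall i, K (n + i) = K i) ->
  kinds_ok n K -> [\/ kinds_cost n K <= 24 * n - 48, heavy5 n K | heavy6 n K].
Proof.
move=> n3 per ok; case: (ltnP n 8) => n8; last by constructor 1; apply: kinds_cost_large.
by apply: kinds_cost_small; rewrite ?n3.
Qed.

(** Reads the distinctness conditions of a configuration off a duplicate-free list of neighbours. *)
Lemma uniq_nth (T : eqType) (x0 : T) l idx :
  uniq l -> uniq idx -> all (fun i => i < size l) idx ->
  uniq [seq nth x0 l i | i <- idx].
Proof.
move=> ul ui /allP lt; rewrite map_inj_in_uniq // => i j /lt li /lt lj /eqP.
by rewrite nth_uniq // => /eqP.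
Qed.

(** * Local arrangements of faces excluded by K4, C5 and C6 *)

(* [R a b c] says that some facial walk runs through [a], [b], [c] in this order.
   Of the rotation system only [turn_anti] is used, which holds at vertices of
   degree at least 3 and is invariant under reversing the orientation; so every
   lemma below also yields its mirror image. *)
Section Turns.
Variables (T : finType) (e : rel T) (R : T -> T -> T -> Prop).
Hypothesis e_sym : symmetric e.
Hypothesis e_irr : irreflexive e.
Hypothesis noK4 : ~ has_K4 e.
Hypothesis noC5 : ~ has_cycle e 5.
Hypothesis noC6 : ~ has_cycle e 6.
Hypothesis turn_edge : forall a b c, R a b c -> [/\ e a b, e b c & a != c].
Hypothesis turn_anti : forall a b c, R a b c -> R c b a -> False.

Lemma edge_neq a b : e a b -> a != b.
Proof. by apply: contraTneq => ->; rewrite e_irr. Qed.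

Lemma K4_free a b c d :
  e a b -> e a c -> e a d -> e b c -> e b d -> e c d -> False.
Proof.
by move=> *; apply: noK4; exists a, b, c, d; apply/and5P; split=> //; apply/andP.
Qed.

Lemma C5_free a b c d f : e a b -> e b c -> e c d -> e d f -> e f a ->
  a != c -> a != d -> b != d -> b != f -> c != f -> False.
Proof.
move=> ab bc cd df fa ac ad bd bf cf; apply: noC5; exists [:: a; b; c; d; f].
split=> //=; last by rewrite ab bc cd df fa.
by rewrite !inE !negb_or (edge_neq ab) (edge_neq bc) (edge_neq cd)
  (edge_neq df) (eq_sym a f) (edge_neq fa) ac ad bd bf cf.
Qed.

Lemma C6_free a b c d f g :
  e a b -> e b c -> e c d -> e d f -> e f g -> e g a ->
  a != c -> a != d -> a != f -> b != d -> b != f -> b != g ->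
  c != f -> c != g -> d != g -> False.
Proof.
move=> ab bc cd df fg ga ac ad af bd bf bg cf cg dg; apply: noC6.
exists [:: a; b; c; d; f; g]; split=> //=; last by rewrite ab bc cd df fg ga.
by rewrite !inE !negb_or (edge_neq ab) (edge_neq bc) (edge_neq cd)
  (edge_neq df) (edge_neq fg) (eq_sym a g) (edge_neq ga) ac ad af bd bf bg cf cg dg.
Qed.

Definition tri_corner x v y := [/\ R x v y, R v y x & R y x v].
Definition quad_corner x v y p := [/\ R x v y, R v y p, R y p x & R p x v].

Ltac turns :=
  repeat match goal with
  | H : tri_corner _ _ _ |- _ => case: H => ? ? ?
  | H : quad_corner _ _ _ _ |- _ => case: H => ? ? ? ?
  end;
  repeat match goal with
  | H : R ?a ?b ?c |- _ =>
     lazymatch goal with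
     | _ : is_true (a != c) |- _ => fail
     | _ => have [? ? ?] := turn_edge H
     end
  end.
Ltac edge := by [assumption | rewrite e_sym; assumption].
(** The last alternative identifies the two vertices and looks for a turn together with its
    reversal. *)
Ltac neq :=
  first [ assumption | (rewrite eq_sym; assumption)
        | (apply: edge_neq; edge)
        | (apply/eqP => ?; subst; exfalso; eauto using turn_anti)].

(** The fan closes up to a K4 if [u = x]; otherwise its boundary is a 5-cycle through [v]. *)
Lemma tri_tri_tri x v y z u :
  tri_corner x v y -> tri_corner y v z -> tri_corner z v u -> False.
Proof.
move=> *; turns; case: (eqVneq u x) => [?|ux].
  by subst u; apply: (@K4_free v x y z); edge.
by apply: (@C5_free v x y z u); first [edge | neq].
Qed.

Lemma tri_quad x v y u p : tri_corner x v y -> quad_corner y v u p -> False.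
Proof.
move=> *; turns; case: (eqVneq u x) => [?|ux].
  by subst u; apply: (turn_anti (a := x) (b := v) (c := y)).
apply: (@C5_free v x y p u); first [edge | neq].
Qed.

(** Deleting the common edge leaves a closed walk of length 6. Only [p = u] or [x = r] can keep it
    from being a 6-cycle, and these produce a 5-cycle or a K4. *)
Lemma quad_quad x v y u p r :
  quad_corner x v y p -> quad_corner y v u r -> False.
Proof.
move=> *; turns.
have ux : u != x by neq.
have pr : p != r by neq.
case: (eqVneq p u) => [?|pu].
  subst u; case: (eqVneq x r) => [?|xr].
    by subst r; apply: (@K4_free v x y p); edge.
  by apply: (@C5_free v x p r y); first [edge | neq].
case: (eqVneq x r) => [?|xr].
  by subst r; apply: (@C5_free v u x p y); first [edge | neq].
by apply: (@C6_free v x p y r u); first [edge | neq].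
Qed.

(** Keeps a closed 3-walk of a glued face away from a pair of triangles: [w = x] gives a K4, and any
    other [w] closes the 5-cycle [v x y z w]. *)
Lemma tri_tri_arrival x v y z w : tri_corner x v y -> tri_corner y v z ->
  R v w z -> R w z v -> False.
Proof.
move=> *; turns.
have wy : w != y by neq.
have xz : x != z by neq.
case: (eqVneq w x) => [?|wx].
  by subst w; apply: (@K4_free v x y z); edge.
by apply: (@C5_free v x y z w); first [edge | neq].
Qed.

(** If the 4-walk came back through another vertex, replacing the edge [v y] by the path [v u y]
    would turn it into a 5-cycle. *)
Lemma tri_departure4 y v u z f : tri_corner y v u ->
  R v y z -> R y z f -> R z f v -> u = f.
Proof.
move=> *; turns.
have uz : u != z by neq.
apply/eqP; case: (eqVneq u f) => // uf; exfalso.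
by apply: (@C5_free v u y z f); first [edge | neq].
Qed.

Lemma departure_tri_arrival y v u z w : tri_corner y v u ->
  R v y z -> R y z v -> R v w u -> R w u v -> False.
Proof.
move=> *; turns.
have uz : u != z by neq.
have wy : w != y by neq.
case: (eqVneq w z) => [?|wz].
  by subst w; apply: (@K4_free v y u z); edge.
by apply: (@C5_free v z y u w); first [edge | neq].
Qed.

End Turns.

(** * Orbits of an injection and sums over them *)

Local Notation order := fingraph.order.
Local Notation orbit := fingraph.orbit.

Section Orbits.
Variables (T : finType) (f : T -> T).
Hypothesis f_inj : injective f.

Lemma iter_inj_order x i j : i < order f x -> j < order f x ->
  iter i f x = iter j f x -> i = j.
Proof.
move=> ltio ltjo eqij; apply/eqP.
by rewrite -(nth_uniq x _ _ (orbit_uniq f x)) ?size_orbit // !nth_traject ?eqij.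
Qed.

Lemma order_iter x i : order f (iter i f x) = order f x.
Proof.
apply: eq_card => y; rewrite !inE.
by rewrite -(same_connect (fconnect_sym f_inj) (fconnect_iter f i x)).
Qed.

Lemma sum_orbit (F : T -> nat) x :
  \sum_(y | fconnect f x y) F y = \sum_(i < order f x) F (iter i f x).
Proof.
transitivity (\sum_(y <- orbit f x) F y).
  rewrite (big_uniq _ (orbit_uniq f x)) /=.
  by apply: eq_bigl => y; rewrite -fconnect_orbit.
rewrite (big_nth x) size_orbit big_mkord.
by apply: eq_bigr => i _; rewrite nth_traject.
Qed.

End Orbits.

(** [4 * 6 + 2 * 12 = 48]. *)
Lemma sum6_marked (F : nat -> nat) i : (forall k, 6 <= F k) -> i < 3 ->
  F i = 12 -> F (i + 3) = 12 -> 48 <= \sum_(k < 6) F k.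
Proof.
move=> F6; rewrite !big_ord_recr big_ord0 /=.
have := F6 0; have := F6 1; have := F6 2; have := F6 3; have := F6 4; have := F6 5.
case: i => [|[|[|i]]] // ? ? ? ? ? ? _; rewrite ?addSn ?add0n; lia.
Qed.

(** [5 * 6 + 2 * 9 = 48]; the condition on [j] says that it is [i + 3] modulo 7. *)
Lemma sum7_marked (F : nat -> nat) i j : (forall k, 6 <= F k) -> i < 7 ->
  (j < 7) && ((j == i + 3) || (j + 4 == i)) ->
  F i = 9 -> F j = 9 -> 48 <= \sum_(k < 7) F k.
Proof.
move=> F6; rewrite !big_ord_recr big_ord0 /=.
have := F6 0; have := F6 1; have := F6 2; have := F6 3; have := F6 4; have := F6 5.
have := F6 6; case: i => [|[|[|[|[|[|[|i]]]]]]] // ? ? ? ? ? ? ? _;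
by case: j => [|[|[|[|[|[|[|j]]]]]]] //= _; lia.
Qed.

(** * Darts, rotation and turns of the embedding *)

Section Embedding.
Variables (T : finType) (e : rel T) (rho : {perm dart e}).
Hypothesis e_sym : symmetric e.
Hypothesis e_irr : irreflexive e.
Hypothesis rot : rotation rho.
Hypothesis mindeg : forall v, 2 < deg e v.
Hypothesis noK4 : ~ has_K4 e.
Hypothesis noC5 : ~ has_cycle e 5.
Hypothesis noC6 : ~ has_cycle e 6.
Hypothesis noC7 : ~ has_cycle e 7.

Implicit Types d : dart e.
Notation src := (@dsrc T e).
Notation rev := (@drev T e).
Notation phi := (face_perm rho).
Notation flen := (order phi).

Definition tgt d : T := (val d).2.

Lemma val_drev d : val (rev d) = (tgt d, src d).
Proof.
by rewrite /drev; case: insubP => [d' _ -> //|]; rewrite /= e_sym (valP d).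
Qed.

Lemma src_drev d : src (rev d) = tgt d. Proof. by rewrite /dsrc val_drev. Qed.
Lemma tgt_drev d : tgt (rev d) = src d. Proof. by rewrite /tgt val_drev. Qed.

Lemma dart_eq d d' : src d = src d' -> tgt d = tgt d' -> d = d'.
Proof.
rewrite /dsrc /tgt => eqs eqt; apply: val_inj.
by rewrite [LHS]surjective_pairing [RHS]surjective_pairing eqs eqt.
Qed.

Lemma drevK : involutive rev.
Proof. by move=> d; apply: dart_eq; rewrite ?src_drev ?tgt_drev ?src_drev. Qed.

Lemma dart_edge d : e (src d) (tgt d). Proof. exact: (valP d). Qed.

Lemma src_rho d : src (rho d) = src d. Proof. by case: rot. Qed.
Lemma src_iter_rho i d : src (iter i rho d) = src d.
Proof. by elim: i => //= i IH; rewrite src_rho. Qed.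

Lemma src_phi d : src (phi d) = tgt d.
Proof. by rewrite /face_perm src_rho src_drev. Qed.

Lemma phi_inj : injective phi.
Proof. by apply: inj_comp; [exact: perm_inj | exact: (can_inj drevK)]. Qed.

Lemma phi_drev d : phi (rev d) = rho d. Proof. by rewrite /face_perm drevK. Qed.

Lemma card_darts_at v : #|[pred d | src d == v]| = deg e v.
Proof.
rewrite -(card_in_image (f := tgt)) => [|d d']; last first.
  by rewrite !inE => /eqP sd /eqP sd'; apply: dart_eq; rewrite sd sd'.
rewrite /deg; apply: eq_card => y; rewrite [RHS]inE; apply/imageP/idP.
  by case=> d /[!inE] /eqP <- ->; exact: dart_edge.
by move=> evy; exists (Sub (v, y) evy); rewrite ?inE /dsrc /tgt SubK.
Qed.

Lemma fconnect_rho d d' : fconnect rho d d' = (src d' == src d).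
Proof.
apply/idP/eqP; last by case: rot => _ h eqs; apply: h.
by move/iter_findex <-; rewrite src_iter_rho.
Qed.

Lemma order_rho d : order rho d = deg e (src d).
Proof. by rewrite -card_darts_at; apply: eq_card => d'; rewrite !inE fconnect_rho. Qed.

Lemma iter_deg d : iter (deg e (src d)) rho d = d.
Proof. by rewrite -order_rho iter_order //; exact: perm_inj. Qed.

Lemma iter_rho_inj d i j : i < deg e (src d) -> j < deg e (src d) ->
  iter i rho d = iter j rho d -> i = j.
Proof. rewrite -order_rho; exact: iter_inj_order. Qed.

(* [turn a b c]: the facial walk that enters [b] from [a] leaves it to [c]. *)
Definition turn a b c := exists d, [/\ src d = b, tgt d = a & tgt (rho d) = c].

Lemma turn_rho d : turn (tgt d) (src d) (tgt (rho d)). Proof. by exists d. Qed.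

Lemma turn_edge a b c : turn a b c -> [/\ e a b, e b c & a != c].
Proof.
case=> d [<- <- <-]; split; [by rewrite e_sym dart_edge | by rewrite -src_rho dart_edge |].
apply/eqP => eqt; have := mindeg (src d).
have /(@iter_rho_inj d 1 0) : rho d = d by apply: dart_eq; rewrite ?src_rho.
by case: (deg e _) => [|[|?]] // /(_ isT isT).
Qed.

(** Opposite turns at a vertex would make [rho] return to [d] after two steps, whereas its cycle
    there has length at least 3. *)
Lemma turn_anti a b c : turn a b c -> turn c b a -> False.
Proof.
case=> d [sd <- <-] [d' [sd' td' t2]]; have := mindeg (src d).
have dd' : d' = rho d by apply: dart_eq; rewrite ?src_rho ?sd.
have /(@iter_rho_inj d 2 0) : rho (rho d) = d.
  by apply: dart_eq; rewrite ?src_rho // -dd'.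
by case: (deg e _) => [|[|[|?]]] // /(_ isT isT).
Qed.

(** * Facial walks and their lengths *)

Definition pt d i : T := src (iter i phi d).

Lemma tgt_iter_phi d i : tgt (iter i phi d) = pt d i.+1.
Proof. by rewrite /pt /= src_phi. Qed.

Lemma pt_turn d i : turn (pt d i) (pt d i.+1) (pt d i.+2).
Proof.
exists (rev (iter i phi d)); split; rewrite ?src_drev ?tgt_drev //.
  by rewrite tgt_iter_phi.
by rewrite -tgt_iter_phi.
Qed.

Lemma pt_edge d i : e (pt d i) (pt d i.+1).
Proof. by have [] := turn_edge (pt_turn d i). Qed.

Lemma pt_neq2 d i : pt d i != pt d i.+2.
Proof. by have [] := turn_edge (pt_turn d i). Qed.

Lemma pt_neq1 d i : pt d i != pt d i.+1.
Proof. exact: edge_neq e_irr _ _ (pt_edge d i). Qed.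

Lemma pt_addn d i j : pt d (i + j) = pt (iter i phi d) j.
Proof. by rewrite /pt addnC iterD. Qed.

Lemma pt_flen d i : pt d (flen d + i) = pt d i.
Proof. by rewrite pt_addn iter_order //; exact: phi_inj. Qed.

(** The dart before [rho d] on its facial walk is [rev d]. Hence the corner belonging to [rho d]
    lies between the edges [d] and [rho d]. *)
Lemma pt_pred d : pt (rho d) (flen (rho d)).-1 = tgt d.
Proof.
have /phi_inj : phi (iter (flen (rho d)).-1 phi (rho d)) = phi (rev d).
  by rewrite phi_drev -iterS orderSpred iter_order //; exact: phi_inj.
by rewrite /pt => ->; rewrite src_drev.
Qed.

Lemma flen_phi d : flen (phi d) = flen d.
Proof. exact: (order_iter phi_inj d 1). Qed.

Lemma flen_ge3 d : 2 < flen d.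
Proof.
have := pt_flen d 0; have := fingraph.order_gt0 phi d.
have := pt_neq1 d 0; have := pt_neq2 d 0.
case: (flen d) => [|[|[|n]]] // n1 n2 _ eqp.
  by move: n2; rewrite [pt d 1]eqp eqxx.
by move: n1; rewrite [pt d 2]eqp eqxx.
Qed.

(** Vertices one or two steps apart on a facial walk differ, and in a closed walk of length 5 every
    two positions are that close, so it would be a 5-cycle. *)
Lemma flen_neq5 d : flen d != 5.
Proof.
apply/eqP => l5; have p5 := pt_flen d 0; have p6 := pt_flen d 1; rewrite l5 in p5 p6.
have h := pt_neq2 d; have := pt_edge d 4; rewrite [pt d 5]p5 => e4.
apply: (@C5_free _ _ e_irr noC5 (pt d 0) (pt d 1) (pt d 2) (pt d 3) (pt d 4));
  rewrite ?pt_edge // eq_sym.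
- by rewrite -[pt d 0]p5.
- by rewrite -[pt d 1]p6.
Qed.

Lemma flen6_glued d : flen d = 6 ->
  exists2 i, i < 3 & pt d i = pt d (i + 3).
Proof.
move=> l6; have p6 := pt_flen d 0; have p7 := pt_flen d 1; rewrite l6 in p6 p7.
have h := pt_neq2 d; have := pt_edge d 5; rewrite [pt d 6]p6 => e5.
have n40 := h 4; rewrite [pt d 6]p6 in n40; have n51 := h 5; rewrite [pt d 7]p7 in n51.
case: (eqVneq (pt d 0) (pt d 3)) => [?|n0]; first by exists 0.
case: (eqVneq (pt d 1) (pt d 4)) => [?|n1]; first by exists 1.
case: (eqVneq (pt d 2) (pt d 5)) => [?|n2]; first by exists 2.
exfalso; apply: (@C6_free _ _ e_irr noC6 (pt d 0) (pt d 1) (pt d 2) (pt d 3)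
  (pt d 4) (pt d 5)); rewrite ?pt_edge //.
- by rewrite eq_sym.
- by rewrite eq_sym.
Qed.

(** Only positions three apart, cyclically, can coincide; if none do, the walk is a 7-cycle. *)
Lemma flen7_glued d : flen d = 7 ->
  exists2 i, i < 7 & pt d i = pt d (i + 3).
Proof.
move=> l7; have p7 := pt_flen d 0; have p8 := pt_flen d 1; have p9 := pt_flen d 2.
rewrite l7 in p7 p8 p9.
have h := pt_neq2 d; have := pt_edge d 6; rewrite [pt d 7]p7 => e6.
have n50 := h 5; rewrite [pt d 7]p7 in n50; have n61 := h 6; rewrite [pt d 8]p8 in n61.
have n60 := pt_neq1 d 6; rewrite [pt d 7]p7 in n60.
have [/existsP [i /eqP ?]|] := boolP [exists i : 'I_7, pt d i == pt d (i + 3)].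
  by exists i.
rewrite negb_exists => /forallP n; exfalso; apply: noC7.
have n3 i (lti : i < 7) : pt d i != pt d (i + 3) by apply: (n (Ordinal lti)).
have := n3 4 isT; have := n3 5 isT; have := n3 6 isT.
rewrite [pt d (4 + 3)]p7 [pt d (5 + 3)]p8 [pt d (6 + 3)]p9 => n62 n51 n40.
exists [seq pt d i | i <- iota 0 7]; split; rewrite ?size_map ?size_iota //.
  rewrite /= !inE !negb_or !pt_neq1 !h (n3 0 isT) (n3 1 isT) (n3 2 isT) (n3 3 isT).
  rewrite -(eq_sym (pt d 4)) n40 -(eq_sym (pt d 5)) n50 -(eq_sym (pt d 6)) n60.
  by rewrite -(eq_sym (pt d 5)) n51 -(eq_sym (pt d 6)) n61 -(eq_sym (pt d 6)) n62.
by rewrite /= !pt_edge e6.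
Qed.


(** * Triangular, quadrangular and glued corners *)

Lemma tri_face d : flen (rho d) = 3 ->
  tri_corner turn (tgt d) (src d) (tgt (rho d)).
Proof.
move=> l3; have := pt_pred d; have := pt_flen (rho d) 0; have := pt_turn (rho d).
have p0 : pt (rho d) 0 = src d by rewrite /pt /= src_rho.
have := tgt_iter_phi (rho d) 0; rewrite l3 p0 /= => p1 t p3 p2.
have := t 0; have := t 1; rewrite p0 p2 -p1 [pt _ 3]p3.
by split=> //; exact: turn_rho.
Qed.

Lemma quad_face d : flen (rho d) = 4 ->
  exists p, quad_corner turn (tgt d) (src d) (tgt (rho d)) p.
Proof.
move=> l4; have := pt_pred d; have := pt_flen (rho d) 0; have := pt_turn (rho d).
have p0 : pt (rho d) 0 = src d by rewrite /pt /= src_rho.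
have := tgt_iter_phi (rho d) 0; rewrite l4 p0 /= => p1 t p4 p3.
have := t 0; have := t 1; have := t 2; rewrite p0 p3 -p1 [pt _ 4]p4.
by exists (pt (rho d) 2); split=> //; exact: turn_rho.
Qed.

(* A facial walk of length 6 or 7 splits at some vertex into two closed walks of
   lengths 3, 3 or 3, 4; [glued] marks its two corners at such a vertex. *)
Definition glued d :=
  ((flen d == 6) || (flen d == 7)) && ((pt d 3 == src d) || (pt d 4 == src d)).

Variant glued_spec d : Prop :=
  | Glued33 of flen d = 6 & pt d 3 = src d
  | Glued34 of flen d = 7 & pt d 3 = src d
  | Glued43 of flen d = 7 & pt d 4 = src d.

Lemma gluedP d : reflect (glued_spec d) (glued d).
Proof.
apply: (iffP idP) => [/andP [l p]|]; last first.
  by case=> l p; rewrite /glued l p !eqxx ?orbT.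
case/orP: l => /eqP l; case/orP: p => /eqP p; try by constructor.
(* A walk of length 6 returning after 4 steps would leave a closed walk of length 2. *)
have := pt_neq2 d 4; have := pt_flen d 0.
by rewrite l p => [] [->]; rewrite eqxx.
Qed.

Lemma departure3 d : pt d 3 = src d ->
  turn (src d) (tgt d) (pt d 2) /\ turn (tgt d) (pt d 2) (src d).
Proof.
move=> p3; have := pt_turn d 0; have := pt_turn d 1.
by rewrite p3 -(tgt_iter_phi d 0).
Qed.

Lemma departure4 d : pt d 4 = src d ->
  [/\ turn (src d) (tgt d) (pt d 2), turn (tgt d) (pt d 2) (pt d 3)
    & turn (pt d 2) (pt d 3) (src d)].
Proof.
move=> p4; have := pt_turn d 0; have := pt_turn d 1; have := pt_turn d 2.
by rewrite p4 -(tgt_iter_phi d 0).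
Qed.

(** Describes the last closed walk before [src d] is reached again through [tgt d]: it has length 3,
    except when a walk of length 7 splits as 3 followed by 4. *)
Lemma arrival d : glued (rho d) ->
  (exists w, turn (src d) w (tgt d) /\ turn w (tgt d) (src d)) \/
  [/\ flen (rho d) = 7, pt (rho d) 3 = src d &
    [/\ turn (src d) (pt (rho d) 4) (pt (rho d) 5),
        turn (pt (rho d) 4) (pt (rho d) 5) (tgt d)
      & turn (pt (rho d) 5) (tgt d) (src d)]].
Proof.
have := pt_pred d; have := pt_flen (rho d) 0; have := pt_turn (rho d).
have -> : pt (rho d) 0 = src d by rewrite /pt /= src_rho.
move=> t; rewrite addn0 => pl pp /gluedP [] l; rewrite src_rho => p; rewrite l /= in pl pp.
- by left; exists (pt (rho d) 4); have := t 3; have := t 4; rewrite p pp pl.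
- by right; split=> //; have := t 3; have := t 4; have := t 5; rewrite p pp pl.
- by left; exists (pt (rho d) 5); have := t 4; have := t 5; rewrite p pp pl.
Qed.

(** Equality would put [rev d], whose source is [pt d 1], at step 2 or 3 of the walk, but [pt d 1]
    differs from [pt d 2] and [pt d 3]. *)
Lemma iter_phi_neq_rho d j : (j == 3) || (j == 4) -> iter j phi d <> rho d.
Proof.
rewrite -phi_drev => h eqj.
have : pt d j.-1 = pt d 1.
  rewrite -(tgt_iter_phi d 0) -src_drev /pt; congr src; apply: phi_inj.
  by rewrite -eqj; case/orP: h => /eqP ->.
by move/esym/eqP; case/orP: h => /eqP ->; apply/negP; rewrite (pt_neq1, pt_neq2).
Qed.

(** The mate is the dart by which the same facial walk leaves [src d] for the second time, after 3
    or 4 steps. *)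
Lemma glued_mate d : glued d -> exists2 j, 1 < j < (deg e (src d)).-1 &
  glued (iter j rho d).
Proof.
move=> gd; have [j j34 [gj sj fj]] : exists2 j, (j == 3) || (j == 4) &
    [/\ glued (iter j phi d), src (iter j phi d) = src d
      & exists2 k, (k == 3) || (k == 4) & iter k phi (iter j phi d) = d].
  have iflen := iter_order phi_inj d.
  case/gluedP: gd => l p; rewrite l in iflen.
  - exists 3 => //; split=> //; last by exists 3; rewrite // -iterD.
    apply/gluedP; constructor 1; rewrite ?(order_iter phi_inj) //.
    by rewrite -[RHS]/(pt d 3) p /pt -iterD iflen.
  - exists 3 => //; split=> //; last by exists 4; rewrite // -iterD.
    apply/gluedP; constructor 3; rewrite ?(order_iter phi_inj) //.
    by rewrite -[RHS]/(pt d 3) p /pt -iterD iflen.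
  - exists 4 => //; split=> //; last by exists 3; rewrite // -iterD.
    apply/gluedP; constructor 2; rewrite ?(order_iter phi_inj) //.
    by rewrite -[RHS]/(pt d 4) p /pt -iterD iflen.
case: fj => k k34 fk.
have /eqP := sj; rewrite -fconnect_rho => con; have := findex_max con.
rewrite order_rho => ltj; have := iter_findex con.
set i := findex _ _ _ in ltj * => eqi; exists i; last by rewrite eqi.
case: i ltj eqi => [|[|i]] lti eqi.
- have ltjl : j < flen d.
    by case/gluedP: gd => -> _; case/orP: j34 => /eqP ->.
  have := iter_inj_order ltjl (fingraph.order_gt0 phi d) (esym eqi).
  by case/orP: j34 => /eqP ->.
- by case: (@iter_phi_neq_rho d j).
rewrite /= ltn_neqAle -ltnS prednK ?lti ?andbT; last by apply: leq_trans (mindeg _).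
(* The last offset would make [d] the [rho]-successor of its mate; the exclusion of offset 1 then
   applies with the roles exchanged. *)
apply/eqP => eqk; case: (@iter_phi_neq_rho (iter j phi d) k) => //.
by rewrite fk -eqi -iterS eqk prednK ?iter_deg // (leq_trans _ (mindeg _)).
Qed.

(** A 4-walk leaving along one side of the triangle must return along the other side, and so it
    joins the two glued corners. Leaving by a 3-walk fails: a 3-walk arrival gives a K4 or a
    5-cycle, and a 4-walk arrival would start at [d] itself. *)
Lemma glued_tri_glued d : glued d -> flen (rho d) = 3 -> glued (rho (rho d)) ->
  [/\ flen d = 7, pt d 4 = src d & iter 4 phi d = rho (rho d)].
Proof.
move=> gd l3 gdd; have tc := tri_face l3.
have dep4 : flen d = 7 -> pt d 4 = src d ->
    [/\ flen d = 7, pt d 4 = src d & iter 4 phi d = rho (rho d)].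
  move=> l7 p4; split=> //; have [t1 t2 t3] := departure4 p4.
  have eqt := tri_departure4 e_irr noC5 turn_edge turn_anti tc t1 t2 t3.
  rewrite iterS [LHS]/face_perm; congr (rho _); apply: dart_eq.
    by rewrite src_rho src_drev tgt_iter_phi p4.
  by rewrite tgt_drev eqt.
have dep3 : pt d 3 = src d -> False.
  move=> p3; have [t1 t2] := departure3 p3; case: (arrival gdd).
    rewrite src_rho => [] [w [t3 t4]].
    exact: (departure_tri_arrival e_sym e_irr noK4 noC5 turn_edge turn_anti tc t1 t2 t3 t4).
  rewrite src_rho => [] [l7 p [t3 t4 t5]].
  have tc' : tri_corner (fun a b c => turn c b a) (tgt (rho d)) (src d) (tgt d).
    by case: tc.
  have eqt : tgt d = pt (rho (rho d)) 4.
    apply: (tri_departure4 (R := fun a b c => turn c b a) e_irr noC5 _ _ tc' t5 t4 t3).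
      by move=> a b c /turn_edge [? ? ?]; rewrite e_sym eq_sym [e b c]e_sym.
    by move=> a b c t t'; apply: turn_anti t' t.
  have eqd : iter 3 phi (rho (rho d)) = d.
    by apply: dart_eq; rewrite ?tgt_iter_phi.
  have : pt d 4 = src d.
    rewrite -{1}eqd -pt_addn; have := pt_flen (rho (rho d)) 0; rewrite l7 => ->.
    by rewrite /pt /= !src_rho.
  by move=> p4; have := pt_neq1 d 3; rewrite p3 p4 eqxx.
by case/gluedP: gd => l p; [case: (dep3 p) | case: (dep3 p) | exact: dep4].
Qed.


Lemma mirror_edge a b c : turn c b a -> [/\ e a b, e b c & a != c].
Proof. by case/turn_edge=> ? ? ?; rewrite e_sym [e b c]e_sym eq_sym. Qed.

Lemma mirror_anti a b c : turn c b a -> turn a b c -> False.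
Proof. by move=> t t'; apply: turn_anti t' t. Qed.

(** * Admissible kinds around a vertex *)

Definition tface d := flen d == 3.

Definition kind_of d :=
  if tface d then Tri else if flen d == 4 then Quad else
  if glued d then Glued else Big.

Lemma tface_kind d : is_tri (kind_of d) = tface d.
Proof. by rewrite /kind_of; case: ifP => //; case: ifP => //; case: ifP. Qed.

Lemma glued_kind d : is_glued (kind_of d) = glued d.
Proof.
rewrite /kind_of /tface; case: ifP => [/eqP l|_].
  by rewrite /glued l.
by case: ifP => [/eqP l|_]; rewrite ?/glued ?l //; case: ifP.
Qed.

Lemma tri_not_quad d : flen (rho d) = 3 -> flen (rho (rho d)) = 4 -> False.
Proof.
move=> /tri_face t /quad_face [p]; rewrite src_rho => q.
exact: tri_quad e_sym e_irr noC5 turn_edge turn_anti _ _ _ _ _ t q.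
Qed.

Lemma quad_not_tri d : flen (rho d) = 4 -> flen (rho (rho d)) = 3 -> False.
Proof.
move=> /quad_face [p [q1 q2 q3 q4]] /tri_face; rewrite src_rho => [] [t1 t2 t3].
by apply: (tri_quad (R := fun a b c => turn c b a) e_sym e_irr noC5 mirror_edge mirror_anti
  (x := tgt (rho (rho d))) (v := src d) (y := tgt (rho d)) (u := tgt d) (p := p)).
Qed.

Lemma quad_not_quad d : flen (rho d) = 4 -> flen (rho (rho d)) = 4 -> False.
Proof.
move=> /quad_face [p q1] /quad_face [p']; rewrite src_rho => q2.
exact: quad_quad e_sym e_irr noK4 noC5 noC6 turn_edge turn_anti _ _ _ _ _ _ q1 q2.
Qed.

Lemma three_tris d : flen (rho d) = 3 -> flen (rho (rho d)) = 3 ->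
  flen (rho (rho (rho d))) = 3 -> False.
Proof.
move=> /tri_face t1 /tri_face; rewrite src_rho => t2 /tri_face; rewrite !src_rho.
exact: tri_tri_tri e_sym e_irr noK4 noC5 turn_edge turn_anti _ _ _ _ _ t1 t2.
Qed.

(** An arrival by a 4-walk would start with the dart [rho d], so one face would have both lengths 3
    and 7. *)
Lemma tri_tri_not_glued d : flen (rho d) = 3 -> flen (rho (rho d)) = 3 ->
  glued (rho (rho (rho d))) -> False.
Proof.
move=> l1 l2 g; have t1 := tri_face l1; have := tri_face l2; rewrite src_rho => t2.
case: (arrival g); rewrite !src_rho.
  case=> w [t3 t4].
  exact: (tri_tri_arrival e_sym e_irr noK4 noC5 turn_edge turn_anti t1 t2 t3 t4).
case=> l7 p [t3 t4 t5].
have eqt : tgt (rho d) = pt (rho (rho (rho d))) 4.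
  apply: (tri_departure4 (R := fun a b c => turn c b a) e_irr noC5 mirror_edge mirror_anti
    (y := tgt (rho (rho d))) (v := src d)) t5 t4 t3.
  by case: t2.
have eqd : iter 3 phi (rho (rho (rho d))) = rho d.
  by apply: dart_eq; [rewrite [RHS]src_rho | rewrite tgt_iter_phi].
have := order_iter phi_inj (rho (rho (rho d))) 3.
by rewrite eqd l1 l7.
Qed.

Lemma glued_not_tri_tri d : glued d -> flen (rho d) = 3 ->
  flen (rho (rho d)) = 3 -> False.
Proof.
move=> g l1 l2; have t1 := tri_face l1; have := tri_face l2; rewrite src_rho => t2.
have dep3 : pt d 3 = src d -> False.
  case/departure3=> t3 t4.
  apply: (tri_tri_arrival (R := fun a b c => turn c b a) e_sym e_irr noK4 noC5
    mirror_edge mirror_anti (x := tgt (rho (rho d))) (v := src d) (y := tgt (rho d))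
    (z := tgt d)) t4 t3; by [case: t2 | case: t1].
case/gluedP: g => l p; [exact: dep3 | exact: dep3 |].
have [t3 t4 t5] := departure4 p.
have eqt := tri_departure4 e_irr noC5 turn_edge turn_anti t1 t3 t4 t5.
have eqd : iter 4 phi d = rho (rho d).
  rewrite iterS [LHS]/face_perm; congr (rho _); apply: dart_eq.
    by rewrite src_rho src_drev tgt_iter_phi p.
  by rewrite tgt_drev eqt.
by have := order_iter phi_inj d 4; rewrite eqd l l2.
Qed.

Lemma kind_pair d : pair_ok (kind_of d) (kind_of (rho d)).
Proof.
(* The face lemmas speak of corners of the form [rho d'], hence the step back to the predecessor. *)
rewrite -[d](permKV rho); set d' := (rho^-1)%g d.
have := @tri_not_quad d'; have := @quad_not_tri d'; have := @quad_not_quad d'.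
rewrite /kind_of /tface; case: (flen (rho d') =P 3) => [l1|_].
  case: (flen (rho (rho d')) =P 3) => // _.
  case: (flen (rho (rho d')) =P 4) => [l2 _ _ /(_ l1 l2) //|_ _ _ _].
  by case: ifP.
case: (flen (rho d') =P 4) => [l1|_]; last first.
  by case: ifP; case: ifP => //; case: ifP => //; case: ifP.
case: (flen (rho (rho d')) =P 3) => [l2 _ /(_ l1 l2) //|_].
case: (flen (rho (rho d')) =P 4) => [l2 /(_ l1 l2) //|_ _ _ _].
by case: ifP.
Qed.

Lemma kind_triple d : triple_ok (kind_of d) (kind_of (rho d)) (kind_of (rho (rho d))).
Proof.
rewrite -[d](permKV rho); set d' := (rho^-1)%g d.
rewrite /triple_ok !tface_kind; apply/andP; split; apply/implyP => /andP [/eqP l1 /eqP l2].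
  rewrite /kind_of /tface.
  case: eqP => [l3|_]; first by case: (three_tris l1 l2 l3).
  case: eqP => [l3|_]; first by case: (tri_not_quad l2 l3).
  by case: ifP => // g3; case: (tri_tri_not_glued l1 l2 g3).
rewrite /kind_of /tface.
case: eqP => [l0|_]; first by case: (three_tris l0 l1 l2).
case: eqP => [l0|_]; first by case: (quad_not_tri l0 l1).
by case: ifP => // g0; case: (glued_not_tri_tri g0 l1 l2).
Qed.

(** The middle corner returns after 3 steps, as the mate of the first, and after 4 steps, as the
    start of the second pattern; these positions are adjacent, hence distinct. *)
Lemma kind_quintuple d : quintuple_ok (kind_of d) (kind_of (rho d))
  (kind_of (rho (rho d))) (kind_of (rho (rho (rho d))))
  (kind_of (rho (rho (rho (rho d))))).
Proof.
rewrite /quintuple_ok !glued_kind !tface_kind.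
apply/negP => /and5P [g1 /eqP l2 g3 /eqP l4 g5].
have [l7 p4 i4] := glued_tri_glued g1 l2 g3.
have [_ p4' _] := glued_tri_glued g3 l4 g5.
have := pt_neq1 (rho (rho d)) 3; rewrite p4' !src_rho -i4 -pt_addn -[4 + 3]/7 -l7.
by rewrite -[flen d]addn0 pt_flen eqxx.
Qed.


(** * Weights of corners and faces *)

Definition weight d :=
  match kind_of d with
  | Tri => 16 | Quad => 12 | Glued => if flen d == 6 then 12 else 9 | Big => 6
  end.

Lemma weight_ge6 d : 6 <= weight d.
Proof. by rewrite /weight; case: kind_of => //; case: ifP. Qed.

Lemma weight_glued d : glued d -> weight d = if flen d == 6 then 12 else 9.
Proof. by rewrite -glued_kind /weight; case: kind_of. Qed.

(** Lengths 3 and 4 give exactly 48. At 6 per corner, lengths 6 and 7 fall short by 12 and 6, which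
    two glued corners supply; from length 8 on, 6 per corner suffices. *)
Lemma face_weight d : 48 <= \sum_(i < flen d) weight (iter i phi d).
Proof.
have flen_it i : flen (iter i phi d) = flen d := order_iter phi_inj d i.
have w6 i := weight_ge6 (iter i phi d).
have glue i : (flen d == 6) || (flen d == 7) -> pt d (i + 3) = pt d i ->
    glued (iter i phi d).
  by move=> l p; rewrite /glued flen_it l -pt_addn p eqxx.
case: (ltnP 7 (flen d)) => [l8|].
  apply: leq_trans (_ : \sum_(i < flen d) 6 <= _); last by apply: leq_sum.
  by rewrite sum_nat_const card_ord; apply: (@leq_mul 8 6 _ 6).
have := flen_neq5 d; have := flen_ge3 d.
case l: (flen d) glue => [|[|[|[|[|[|[|[|n]]]]]]]] // glue _ _ _.
- have wi i : weight (iter i phi d) = 16 by rewrite /weight /kind_of /tface flen_it l.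
  by rewrite !big_ord_recr big_ord0 !wi.
- have wi i : weight (iter i phi d) = 12 by rewrite /weight /kind_of /tface flen_it l.
  by rewrite !big_ord_recr big_ord0 !wi.
- have wg i : pt d (i + 3) = pt d i -> weight (iter i phi d) = 12.
    by move=> p; rewrite weight_glued ?flen_it ?l //; apply: glue.
  have [i lti eqp] := flen6_glued l.
  have /esym/wg wi := eqp.
  have /wg wi3 : pt d (i + 3 + 3) = pt d (i + 3).
    by have := pt_flen d i; rewrite l -addnA addnC => ->.
  exact: (sum6_marked (F := fun i => weight (iter i phi d)) w6 lti wi wi3).
- have wg i : glued (iter i phi d) -> weight (iter i phi d) = 9.
    by move=> g; rewrite weight_glued ?flen_it ?l //.
  have [i lti eqp] := flen7_glued l.
  have /wg wi : glued (iter i phi d) by exact: glue.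
  have : exists2 j, weight (iter j phi d) = 9 & (j < 7) && ((j == i + 3) || (j + 4 == i)).
    have g : glued (iter (i + 3) phi d).
      have p7 : pt d (i + 3 + 4) = pt d i.
        by have := pt_flen d i; rewrite l -addnA addnC.
      by apply/andP; split; [rewrite flen_it l | apply/orP; right; rewrite -pt_addn p7 eqp].
    case: (ltnP i 4) => i4; first exists (i + 3); rewrite ?wg //.
      by rewrite eqxx andbT (leq_add i4 (leqnn 3)).
    exists (i - 4); last by rewrite subnK // eqxx orbT andbT (leq_ltn_trans (leq_subr _ _)).
    apply: wg; move: g; rewrite -{1}(subnK i4) -addnA addnC iterD.
    have := iter_order phi_inj d; rewrite l -iterD addnC iterD => ->.
    by [].
  case=> j wj hj.
  exact: (sum7_marked (F := fun i => weight (iter i phi d)) w6 lti hj wi wj).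
Qed.

Lemma faces_weight : 48 * fcard phi predT <= \sum_d weight d.
Proof.
rewrite (partition_big (froot phi) (mem (froots phi))) => [|d _]; last first.
  exact: roots_root (fconnect_sym phi_inj) d.
apply: leq_trans (_ : \sum_(r in froots phi) 48 <= _).
  rewrite sum_nat_const mulnC leq_mul2r /= /n_comp_mem; apply: subset_leq_card.
  by apply/subsetP => r; rewrite !inE andbT.
apply: leq_sum => r rt; apply: leq_trans (face_weight r) _.
rewrite -sum_orbit; apply: eq_leq; apply: eq_bigl => d /=.
by rewrite -(root_connect (fconnect_sym phi_inj)) eq_sym (eqP rt).
Qed.


(** * Transfers within triangles and diamonds *)

Definition spine d := tface d && tface (rev d).

Lemma tface_phi d : tface (phi d) = tface d.
Proof. by rewrite /tface flen_phi. Qed.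

Lemma tface_rho d : tface (rho d) = tface (rev d).
Proof. by rewrite -phi_drev tface_phi. Qed.

Lemma phi3 d : tface d -> phi (phi (phi d)) = d.
Proof. by move=> /eqP l; have := iter_order phi_inj d; rewrite l. Qed.

Lemma spine_rev d : spine (rev d) = spine d.
Proof. by rewrite /spine drevK andbC. Qed.

Lemma spine_rho d : spine d = tface d && tface (rho d).
Proof. by rewrite tface_rho. Qed.

Lemma spine_phi2_rho d : tface (rho d) -> spine (phi (phi (rho d))) = tface d.
Proof.
move=> t; have -> : phi (phi (rho d)) = rev d.
  by apply: phi_inj; rewrite phi3 // phi_drev.
by rewrite /spine drevK -tface_rho t.
Qed.

(** Two spine edges on one triangle would produce three consecutive triangular corners. So each
    triangle belongs to at most one diamond. *)
Lemma spine_phi2F d : spine d -> spine (phi (phi d)) = false.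
Proof.
rewrite -[d](permKV rho); set d' := (rho^-1)%g d; rewrite spine_rho => /andP [t1 t2].
rewrite spine_phi2_rho //; apply/negP => t0.
move: t0 t1 t2; rewrite -[d'](permKV rho) => /eqP t0 /eqP t1 /eqP t2.
exact: three_tris t0 t1 t2.
Qed.

Lemma spine_phiF d : spine d -> spine (phi d) = false.
Proof.
move=> sd; apply/negP => /spine_phi2F; rewrite phi3 ?sd //.
by case/andP: sd.
Qed.

Lemma tface_tri d : tface d -> tri e (src d) (tgt d) (tgt (phi d)).
Proof.
move=> t; have := dart_edge (phi (phi d)); have := dart_edge (phi d).
rewrite -[tgt (phi (phi d))]src_phi phi3 // !src_phi => h1 h2.
by rewrite /tri dart_edge h1 e_sym.
Qed.

Lemma spine_diamond d : spine d ->
  diamond e (src d) (tgt d) (tgt (phi d)) (tgt (phi (rev d))).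
Proof.
move=> /andP [t t']; have := tface_tri t; have := tface_tri t'.
rewrite src_drev tgt_drev => /and3P [_ h1 h2] /and3P [h3 h4 h5].
apply/and5P; split=> //; rewrite h2 /=; apply/eqP => eqs.
have := pt_turn d 0; have := pt_turn (rev d) 2.
have -> : pt (rev d) 3 = tgt d by rewrite /pt /= phi3 // src_drev.
have -> : pt (rev d) 4 = src d by rewrite /pt /= (phi3 t') src_phi tgt_drev.
rewrite -(tgt_iter_phi d 0) -(tgt_iter_phi d 1) -(tgt_iter_phi (rev d) 1) /= eqs.
by move=> t1 t2; apply: turn_anti t2 t1.
Qed.

Notation dg := (deg e).

(** A 3-vertex may keep [24 * 3 - 48 = 24]. Its corners weigh [16 + 6 + 6 = 28] on a single triangle
    and [16 + 16 + 6 = 38] in the middle of a diamond, whence the surpluses 4 and 14. *)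
Definition gain x := if dg x == 3 then 4 else 0.
Definition aid x := if dg x <= 3 then 0 else if dg x == 4 then 2 else 8.

(* What a diamond with middle vertices [x], [y] and sides [s1], [s2] asks of [x]
   when [dg x >= 5]; the subtraction is truncated. *)
Definition demand y s1 s2 :=
  if 3 < dg y then 4 else 14 + gain s1 + gain s2 - (aid s1 + aid s2).

Definition spine_give x y s1 s2 :=
  if dg x == 3 then 0 else if dg x == 4 then 4 else demand y s1 s2.

Definition single_give x y z :=
  if dg x == 3 then 0 else if dg x == 4 then 2 else
  if (dg y == 3) || (dg z == 3) then 8 else 0.

(** Of the two corners of a diamond at a middle vertex, the one whose dart is the spine settles for
    both; [spine (phi (phi d))] recognises the other. Side vertices act as on a single triangle. *)
Definition give d :=
  if ~~ tface d then 0 else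
  if spine d then spine_give (src d) (tgt d) (tgt (phi d)) (tgt (phi (rev d)))
  else if spine (phi (phi d)) then 0
  else single_give (src d) (tgt d) (tgt (phi d)).

Definition get d :=
  if ~~ tface d then 0 else
  if spine d then (if dg (src d) == 3 then 14 else 0)
  else if spine (phi (phi d)) then 0
  else gain (src d).

Definition bare d :=
  [&& tface d, ~~ spine d, ~~ spine (phi d) & ~~ spine (phi (phi d))].

Definition tot (f : dart e -> nat) d := f d + f (phi d) + f (phi (phi d)).

Lemma bare_phi d : bare (phi d) = bare d.
Proof.
rewrite /bare tface_phi; case t: (tface d) => //=; rewrite phi3 //.
by case: (spine d); case: (spine (phi d)); case: (spine (phi (phi d))).
Qed.

Lemma sum_phi (f : dart e -> nat) : \sum_d f (phi d) = \sum_d f d.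
Proof. by rewrite [RHS](reindex_inj phi_inj). Qed.

(** A bare triangle is met at three darts and a diamond at two spine darts; the factors 2 and 3 make
    either count 6. *)
Lemma sum_clusters f : (forall d, ~~ tface d -> f d = 0) ->
  6 * \sum_d f d = \sum_d (2 * (bare d * tot f d) +
                           3 * (spine d * (tot f d + tot f (rev d)))).
Proof.
move=> f0.
(* On a triangular dart exactly one of the four indicators is 1. *)
have split4 : \sum_d f d = \sum_d bare d * f d + \sum_d spine d * f d
    + \sum_d spine (phi d) * f d + \sum_d spine (phi (phi d)) * f d.
  rewrite -!big_split /=; apply: eq_bigr => d _; rewrite /bare.
  case t: (tface d) => /=; last by rewrite f0 ?t // !muln0.
  case s0: (spine d); first by rewrite (spine_phiF s0) (spine_phi2F s0); lia.
  case s1: (spine (phi d)); first by rewrite (spine_phiF s1); lia.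
  case: (spine (phi (phi d))) => /=; lia.
have e1 : \sum_d spine (phi d) * f d = \sum_d spine d * f (phi (phi d)).
  rewrite -[RHS]sum_phi; apply: eq_bigr => d _; case s: (spine (phi d)) => //.
  by rewrite phi3 //; case/andP: s; rewrite tface_phi.
have e2 : \sum_d spine (phi (phi d)) * f d = \sum_d spine d * f (phi d).
  rewrite -[RHS]sum_phi -[RHS]sum_phi; apply: eq_bigr => d _.
  case s: (spine (phi (phi d))) => //; rewrite phi3 //.
  by case/andP: s; rewrite !tface_phi.
have e3 : \sum_d bare d * tot f d = 3 * \sum_d bare d * f d.
  have : \sum_d bare d * tot f d = \sum_d bare d * f d + \sum_d bare d * f (phi d)
      + \sum_d bare d * f (phi (phi d)).
    by rewrite -!big_split /=; apply: eq_bigr => d _; rewrite -!mulnDr.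
  have <- : \sum_d bare d * f (phi d) = \sum_d bare d * f d.
    by rewrite -[RHS]sum_phi; apply: eq_bigr => d _; rewrite bare_phi.
  have <- : \sum_d bare d * f (phi (phi d)) = \sum_d bare d * f (phi d).
    by rewrite -[RHS]sum_phi; apply: eq_bigr => d _; rewrite bare_phi.
  lia.
have e4 : \sum_d spine d * tot f d = \sum_d spine d * f d
    + \sum_d spine d * f (phi (phi d)) + \sum_d spine d * f (phi d).
  by rewrite -!big_split /=; apply: eq_bigr => d _; rewrite -!mulnDr addnAC.
have e5 : \sum_d spine d * tot f (rev d) = \sum_d spine d * tot f d.
  rewrite [RHS](reindex_inj (can_inj drevK)) /=.
  by apply: eq_bigr => d _; rewrite spine_rev.
have -> : \sum_d (2 * (bare d * tot f d) + 3 * (spine d * (tot f d + tot f (rev d))))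
  = 2 * (\sum_d bare d * tot f d) + 3 * (\sum_d spine d * tot f d)
    + 3 * (\sum_d spine d * tot f (rev d)).
  rewrite !big_distrr /= -!big_split /=; apply: eq_bigr => d _; lia.
rewrite e5 e4 e3 split4 e1 e2; lia.
Qed.

Hypothesis noD2 : ~ D2 e.
Hypothesis noD4 : ~ D4 e.
Hypothesis noD6 : ~ D6 e.

Lemma tri_deg x y z : tri e x y z -> dg x = 3 -> dg y = 3 -> 4 < dg z.
Proof.
move=> t dx dy; have := mindeg z; case: (ltnP 4 (dg z)) => // z4 z3; case: noD2.
exists x, y, z; rewrite t dx dy /=; lia.
Qed.

Lemma triC x y z : tri e x y z = tri e y z x.
Proof.
rewrite /tri [e y x]e_sym [e z x]e_sym.
by case: (e x y); case: (e y z); case: (e x z).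
Qed.

(** A single 3-vertex needs 4 and the other two pay at least 2 each; two 3-vertices need 8, paid by
    the third, whose degree is at least 5 by [tri_deg]. *)
Lemma bare_balance d : bare d -> tot get d <= tot give d.
Proof.
case/and4P=> t s0 s1 s2; rewrite /tot /get /give !tface_phi t /= phi3 //.
rewrite (negbTE s0) (negbTE s1) (negbTE s2) !src_phi.
have -> : tgt (phi (phi d)) = src d by rewrite -src_phi phi3.
have tr := tface_tri t; have h1 := tri_deg tr; rewrite triC in tr.
have h2 := tri_deg tr; rewrite triC in tr; have h3 := tri_deg tr.
have m1 := mindeg (src d); have m2 := mindeg (tgt d); have m3 := mindeg (tgt (phi d)).
rewrite /gain /single_give.
move: (dg (src d)) (dg (tgt d)) (dg (tgt (phi d))) h1 h2 h3 m1 m2 m3.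
move=> a b c h1 h2 h3 m1 m2 m3.
case: a h1 h2 h3 m1 => [|[|[|[|[|a]]]]] // h1 h2 h3 _;
case: b h1 h2 h3 m2 => [|[|[|[|[|b]]]]] // h1 h2 h3 _;
case: c h1 h2 h3 m3 => [|[|[|[|[|c]]]]] // h1 h2 h3 _;
by [| have := h1 erefl erefl | have := h2 erefl erefl | have := h3 erefl erefl].
Qed.

(** Middle vertices of degree at least 4 pay 4 each, enough for both sides. With one middle
    3-vertex, a partner of degree at least 5 pays the demand; a 4-vertex pays 4, its sides have
    degree at least 4 and by D6 not both 4, so they add at least [2 + 8]. Two middle 3-vertices are
    excluded by D2 and D4. *)
Lemma spine_balance d : spine d ->
  tot get d + tot get (rev d) <= tot give d + tot give (rev d).
Proof.
move=> s; have s' := s; rewrite -spine_rev in s'.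
have /andP [t t'] := s.
have f1 := spine_phiF s; have f2 := spine_phi2F s.
have f1' := spine_phiF s'; have f2' := spine_phi2F s'.
rewrite /tot /get /give !tface_phi t t' /= !(phi3 t) !(phi3 t') s s' f1 f2 f1' f2' /=.
rewrite !src_phi drevK src_drev tgt_drev.
have -> : tgt (phi (phi d)) = src d by rewrite -src_phi phi3.
have -> : tgt (phi (phi (rev d))) = tgt d by rewrite -src_phi phi3 // src_drev.
have dia := spine_diamond s.
have noD4' : dg (src d) = 3 -> dg (tgt d) = 3 ->
    3 < dg (tgt (phi d)) -> 3 < dg (tgt (phi (rev d))) -> False.
  move=> h1 h2 h3 h4; apply: noD4; do 4 eexists; apply/andP; split; first exact: dia.
  by rewrite /= h1 h2 h3 h4.
have noD6' : dg (src d) = 4 -> dg (tgt d) = 3 ->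
    dg (tgt (phi d)) = 4 -> dg (tgt (phi (rev d))) = 4 -> False.
  move=> h1 h2 h3 h4; apply: noD6; do 4 eexists; apply/andP; split; first exact: dia.
  by rewrite /= h1 h2 h3 h4.
have noD6'' : dg (src d) = 3 -> dg (tgt d) = 4 ->
    dg (tgt (phi d)) = 4 -> dg (tgt (phi (rev d))) = 4 -> False.
  have dia' := spine_diamond s'; rewrite drevK src_drev tgt_drev in dia'.
  move=> h1 h2 h3 h4; apply: noD6; do 4 eexists; apply/andP; split; first exact: dia'.
  by rewrite /= h1 h2 h3 h4.
have tr := tface_tri t; have tr' := tface_tri t'; rewrite src_drev tgt_drev in tr'.
have h1 := tri_deg tr; rewrite triC in tr; have h2 := tri_deg tr.
rewrite triC in tr; have h3 := tri_deg tr.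
have k1 := tri_deg tr'; rewrite triC in tr'; have k2 := tri_deg tr'.
rewrite triC in tr'; have k3 := tri_deg tr'.
have m1 := mindeg (src d); have m2 := mindeg (tgt d).
have m3 := mindeg (tgt (phi d)); have m4 := mindeg (tgt (phi (rev d))).
rewrite /gain /single_give /spine_give /demand /gain /aid.
move: (dg (src d)) (dg (tgt d)) (dg (tgt (phi d))) (dg (tgt (phi (rev d))))
  h1 h2 h3 k1 k2 k3 m1 m2 m3 m4 noD4' noD6' noD6'' =>
  a b c f h1 h2 h3 k1 k2 k3 m1 m2 m3 m4 d4 d6 d6'.
case: a h1 h2 h3 k1 k2 k3 m1 d4 d6 d6' => [|[|[|[|[|a]]]]] // h1 h2 h3 k1 k2 k3 _ d4 d6 d6';
case: b h1 h2 h3 k1 k2 k3 m2 d4 d6 d6' => [|[|[|[|[|b]]]]] // h1 h2 h3 k1 k2 k3 _ d4 d6 d6';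
case: c h1 h2 h3 m3 d4 d6 d6' => [|[|[|[|[|c]]]]] // h1 h2 h3 _ d4 d6 d6';
case: f k1 k2 k3 m4 d4 d6 d6' => [|[|[|[|[|f]]]]] // k1 k2 k3 _ d4 d6 d6';
by [| case: d4 | case: d6 | case: d6' | have := h1 erefl erefl | have := h2 erefl erefl
    | have := h3 erefl erefl | have := k1 erefl erefl | have := k2 erefl erefl
    | have := k3 erefl erefl].
Qed.

Lemma sum_get_give : \sum_d get d <= \sum_d give d.
Proof.
rewrite -(leq_pmul2l (m := 6)) // !sum_clusters; last 2 first.
- by move=> d t; rewrite /give t.
- by move=> d t; rewrite /get t.
apply: leq_sum => d _; rewrite leq_add // leq_mul2l /=.
  by case b: (bare d); rewrite ?mul1n ?bare_balance.
by case s: (spine d); rewrite ?mul1n ?spine_balance.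
Qed.


(** * Costs of corners and of vertices *)

Hypothesis noD3 : ~ D3 e.
Hypothesis noD7 : ~ D7 e.
Hypothesis noD9 : ~ D9 e.
Hypothesis noD10 : ~ D10 e.
Hypothesis noD11 : ~ D11 e.
Hypothesis noD12 : ~ D12 e.

Notation spine_demand d := (demand (tgt d) (tgt (phi d)) (tgt (phi (rev d)))).

Lemma diamondC x y s t : diamond e x y s t = diamond e x y t s.
Proof.
rewrite /diamond eq_sym.
by case: (e x y); case: (e x s); case: (e y s); case: (e x t); case: (e y t).
Qed.

(** With a middle 3-vertex, side degrees 3 and 4 give 16, 3 and at least 5 give 10, 4 and 4 give 10,
    and the larger pairs at most 4. The closing disjunction allows either order of the sides. *)
Variant demand_spec d : Prop :=
  | DemandLow of spine_demand d <= 4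
  | DemandMid3 s s' of spine_demand d = 10 & dg (tgt d) = 3 & dg s = 3
      & diamond e (src d) (tgt d) s s'
      & [:: s; s'] = [:: tgt (phi d); tgt (phi (rev d))] \/
        [:: s'; s] = [:: tgt (phi d); tgt (phi (rev d))]
  | DemandMid4 of spine_demand d = 10 & dg (tgt d) = 3 & dg (tgt (phi d)) = 4
      & dg (tgt (phi (rev d))) = 4
  | DemandHigh s s' of spine_demand d = 16 & dg (tgt d) = 3 & dg s = 4 & dg s' = 3
      & diamond e (src d) (tgt d) s s'
      & [:: s; s'] = [:: tgt (phi d); tgt (phi (rev d))] \/
        [:: s'; s] = [:: tgt (phi d); tgt (phi (rev d))].

(** Two sides of degree 3 would form with the middle 3-vertex a path as in D9, its ends being
    non-adjacent for lack of a K4. *)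
Lemma demandP d : spine d -> demand_spec d.
Proof.
move=> sd; have dia := spine_diamond sd; have dia' := dia; rewrite diamondC in dia'.
have both3 : dg (tgt d) = 3 -> dg (tgt (phi d)) = 3 -> dg (tgt (phi (rev d))) = 3 -> False.
  case/and5P: dia => h1 h2 h3 h4 /andP [h5 h6] dy ds1 ds2; apply: noD9.
  exists (tgt (phi d)), (tgt d), (tgt (phi (rev d))).
  rewrite ds1 dy ds2 h6 e_sym h3 h5 /= andbT; apply/negP => h7.
  exact: (K4_free noK4 h1 h2 h4 h3 h5 h7).
have my := mindeg (tgt d); have m1 := mindeg (tgt (phi d)).
have m2 := mindeg (tgt (phi (rev d))).
case: (ltnP 3 (dg (tgt d))) => [y4|y3].
  by constructor 1; rewrite /demand y4.
have dy : dg (tgt d) = 3 by lia.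
have dem : spine_demand d = 14 + gain (tgt (phi d)) + gain (tgt (phi (rev d)))
    - (aid (tgt (phi d)) + aid (tgt (phi (rev d)))) by rewrite /demand dy.
case d1: (dg (tgt (phi d))) m1 => [|[|[|[|[|k1]]]]] // _;
case d2: (dg (tgt (phi (rev d)))) m2 => [|[|[|[|[|k2]]]]] // _;
  rewrite /gain /aid d1 d2 /= in dem.
- by case: both3.
- by apply: (DemandHigh dem dy d2 d1 dia'); right.
- by apply: (DemandMid3 dem dy d1 dia); left.
- by apply: (DemandHigh dem dy d1 d2 dia); left.
- exact: DemandMid4.
- by constructor 1; rewrite dem.
- by apply: (DemandMid3 dem dy d2 dia'); right.
- by constructor 1; rewrite dem.
- by constructor 1; rewrite dem.
Qed.

Definition cost d := weight d + give d - get d.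

(** The subtraction in [cost] is never truncated: only triangular corners receive, at most 14, and
    they weigh 16. *)
Lemma costK d : cost d + get d = weight d + give d.
Proof.
rewrite /cost subnK //; apply: leq_trans (leq_addr _ _); rewrite /get.
case t: (tface d) => //=; rewrite /weight /kind_of t /gain.
by case: ifP => _; case: ifP => // _; case: ifP.
Qed.

Lemma cost_tface d : tface d -> cost d = 16 + give d - get d.
Proof. by move=> t; rewrite /cost /weight /kind_of t. Qed.

Lemma cost_ntface d : ~~ tface d -> cost d = weight d.
Proof. by move=> t; rewrite /cost /give /get t addn0 subn0. Qed.

Lemma cost_spine d : spine d -> 4 < dg (src d) -> cost d = 16 + spine_demand d.
Proof.
move=> s d5; have /andP [t _] := s; rewrite cost_tface // /give /get t s /= /spine_give.
by case: (dg (src d)) d5 => [|[|[|[|[|k]]]]] //= _; rewrite subn0.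
Qed.

Lemma cost_second d : tface d -> tface (rho d) -> ~~ tface (rho (rho d)) ->
  cost (rho d) = 16.
Proof.
move=> t1 t2 t3; rewrite cost_tface // /give /get t2 spine_rho t2 (negbTE t3) /=.
by rewrite spine_phi2_rho // t1.
Qed.

Lemma tgt_phi_rho d : tface (rho d) -> tgt (phi (rho d)) = tgt d.
Proof.
move=> t; rewrite -src_phi -src_drev; congr src.
by apply: phi_inj; rewrite phi3 // phi_drev.
Qed.

Lemma cost_single d : ~~ tface d -> tface (rho d) -> ~~ tface (rho (rho d)) ->
  4 < dg (src d) -> cost (rho d) = 16 + single_give (src d) (tgt (rho d)) (tgt d).
Proof.
move=> t1 t2 t3 d5; rewrite cost_tface // /give /get t2 spine_rho t2 (negbTE t3) /=.
rewrite spine_phi2_rho // (negbTE t1) src_rho tgt_phi_rho // /gain.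
by case: (dg (src d)) d5 => [|[|[|[|[|k]]]]] //= _; rewrite subn0.
Qed.

(** A glued corner separated from another by one triangle lies on a walk of length 7 and weighs 9.
    Spine corners use that no demand exceeds 16. *)
Lemma cost_corner d : cost (rho (rho d)) <=
  corner_cost (dg (src d)) (kind_of d) (kind_of (rho d)) (kind_of (rho (rho d)))
    (kind_of (rho (rho (rho d)))) (kind_of (rho (rho (rho (rho d))))).
Proof.
set x := rho (rho d); have sx : src x = src d by rewrite /x !src_rho.
have gx := glued_kind x; have tx := tface_kind x.
rewrite /corner_cost !tface_kind !glued_kind.
case kx: (kind_of x) gx tx => /= /esym gx /esym tx.
- rewrite cost_tface // /give /get tx /= spine_rho tx sx /spine_cost /single_cost /=.
  have -> : spine (phi (phi x)) = tface (rho d) by rewrite spine_phi2_rho.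
  have m := mindeg (src d).
  case t3: (tface (rho x)).
    have sp : spine x by rewrite spine_rho tx t3.
    have dem : spine_demand x <= 16.
      by case: (demandP sp) => [|? ? -> _ _ _ _|-> |? ? ->] //; lia.
    rewrite /spine_give; case: (dg (src d)) m => [|[|[|[|[|k]]]]] //= _; lia.
  case: (tface (rho d)) => //.
  rewrite /single_give /gain; case: (dg (src d)) m => [|[|[|[|[|k]]]]] //= _.
  by case: ifP.
- by rewrite cost_ntface ?tx // /weight kx.
- rewrite cost_ntface ?tx // /weight kx.
  case: (flen x =P 6) => [l6|_]; last by case: ifP.
  case: ifP => // /orP [] /andP [h1 h2].
    by have [] := glued_tri_glued gx (eqP h1) h2; rewrite l6.
  have [l7 _ i4] := glued_tri_glued h1 (eqP h2) gx.
  by have := order_iter phi_inj d 4; rewrite i4 -/x l6 l7.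
- by rewrite cost_ntface ?tx // /weight kx.
Qed.

Lemma uniq_nbrs d k : k <= dg (src d) ->
  uniq (src d :: [seq tgt (iter i rho d) | i <- iota 0 k]).
Proof.
move=> lek; rewrite cons_uniq; apply/andP; split.
  apply/negP => /mapP [i _ eqs]; have := dart_edge (iter i rho d).
  by rewrite src_iter_rho -eqs e_irr.
rewrite map_inj_in_uniq ?iota_uniq // => i j.
rewrite !mem_iota !add0n => /andP [_ li] /andP [_ lj] eqt.
apply: (@iter_rho_inj d); rewrite ?(leq_trans li) ?(leq_trans lj) //.
by apply: dart_eq; rewrite ?src_iter_rho.
Qed.

(** Demand 16 is D10. With a further 3-neighbour outside the diamond, demand 10 is D11 or D7,
    according to whether a side has degree 3. *)
Lemma demand_deg5 d : spine d -> dg (src d) = 5 ->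
  spine_demand d <= 10 /\ forall w, e w (src d) -> dg w = 3 ->
    w \notin [:: src d; tgt d; tgt (phi d); tgt (phi (rev d))] -> spine_demand d <= 4.
Proof.
move=> sd d5; have dia := spine_diamond sd.
case: (demandP sd) => [le4|s s' -> dy ds ds's eqs|-> dy ds ds'|s s' _ dy ds ds' dss _].
- by split=> //; apply: leq_trans le4 _.
- split=> // w ew dw; rewrite !inE !negb_or => /and4P [w1 w2 w3 w4]; case: noD11.
  case/and5P: ds's => h1 h2 h3 h4 _.
  exists (src d), (tgt d), s, w; rewrite /tri h1 h2 h3 d5 dy ds dw ew /=.
  rewrite !inE !negb_or w1 w2 /=.
  by case: eqs => [] [? ?]; subst.
- split=> // w ew dw wn; case: noD7.
  exists (src d), (tgt d), (tgt (phi d)), (tgt (phi (rev d))), w.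
  by rewrite /dia_cfg dia wn ew /= d5 dy ds ds' dw.
- case: noD10; exists (src d), (tgt d), s, s'.
  by rewrite /dia_cfg dss /= d5 dy ds ds'.
Qed.

(** The fixed part is 60, so the demand and the payment to the single triangle must fit into 12. The
    latter is 0 or 8, and 8 supplies a 3-neighbour outside the diamond. *)
Lemma heavy5_cost d : dg (src d) = 5 -> tface d -> tface (rho d) ->
  is_big (kind_of (iter 2 rho d)) -> tface (iter 3 rho d) ->
  is_big (kind_of (iter 4 rho d)) ->
  \sum_(i < 5) cost (iter i rho d) <= 72.
Proof.
move=> d5 t0 t1 b2 t3 b4.
have nt x : is_big (kind_of x) -> ~~ tface x by rewrite -tface_kind; case: kind_of.
have cb x : is_big (kind_of x) -> cost x = 6.
  by move=> b; rewrite cost_ntface ?nt // /weight; case: kind_of b.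
have sp : spine d by rewrite spine_rho t0 t1.
have d05 : rho (iter 4 rho d) = d by have := iter_deg d; rewrite d5.
have U := @uniq_nbrs d 5; rewrite d5 in U; have {}U := U isT.
have s1 : tgt (phi d) = tgt (iter 4 rho d) by rewrite -{1}d05 tgt_phi_rho // d05.
have s2 : tgt (phi (rev d)) = tgt (rho d) by rewrite phi_drev.
have [dem10 dem4] := demand_deg5 sp d5.
have c0 : cost d = 16 + spine_demand d by rewrite cost_spine // d5.
have c1 : cost (rho d) = 16 by apply: cost_second => //; apply: nt b2.
have c3 := @cost_single (iter 2 rho d) (nt _ b2) t3 (nt _ b4).
rewrite src_iter_rho d5 in c3; have {}c3 := c3 isT.
have -> : \sum_(i < 5) cost (iter i rho d) = cost d + cost (rho d) + cost (iter 2 rho d)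
    + cost (rho (iter 2 rho d)) + cost (iter 4 rho d) by rewrite !big_ord_recr big_ord0.
rewrite c0 c1 (cb _ b2) (cb _ b4) c3.
suff : spine_demand d + single_give (src d) (tgt (rho (iter 2 rho d)))
    (tgt (iter 2 rho d)) <= 12.
  by move: (spine_demand d) (single_give _ _ _); clear=> k1 k2; lia.
rewrite /single_give d5 /=; case: ifP => [hh|_]; last by rewrite addn0 (leq_trans dem10).
have dem i : (i == 2) || (i == 3) -> dg (tgt (iter i rho d)) == 3 -> spine_demand d <= 4.
  move=> i23 /eqP di; apply: (dem4 (tgt (iter i rho d))) => //.
    by rewrite e_sym -{1}(src_iter_rho i d) dart_edge.
  rewrite s1 s2.
  (* In [U] the centre stands at position 0 and the target of [iter i rho d] at position [i.+1]. *)
  have /= := uniq_nth (src d) (idx := [:: i.+1; 0; 1; 5; 2]) U.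
  case/orP: i23 => /eqP -> /=; by case/(_ isT isT)/andP.
suff : spine_demand d <= 4 by move: (spine_demand d); clear=> k; lia.
by move: hh => /orP [/(dem 3)|/(dem 2)]; exact.
Qed.

(** Demand 16 provides a T(6,3,3) and sides of degrees 4 and 3. If the other diamond also has a
    3-side, D12 arises; if its sides are both 4-vertices, D3 does. *)
Lemma demand_deg6 d d' : spine d -> spine d' -> dg (src d) = 6 -> src d' = src d ->
  uniq [:: src d; tgt d; tgt (phi d); tgt (phi (rev d));
           tgt d'; tgt (phi d'); tgt (phi (rev d'))] ->
  spine_demand d = 16 -> spine_demand d' <= 4.
Proof.
move=> sd sd' d6 ss' U dem16.
have V := fun idx => uniq_nth (src d) (idx := idx) U.
have dia' := spine_diamond sd'; rewrite ss' in dia'.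
case: (demandP sd) => [|? ? |//|s t _ dy ds dt dst st]; rewrite ?dem16 //.
have high s'' t'' y'' : diamond e (src d) y'' s'' t'' ->
    dg y'' = 3 -> dg s'' = 3 -> uniq [:: src d; tgt d; t; y''; s''] -> False.
  move=> dia dy'' ds'' U'; apply: noD12; exists (src d), (tgt d), t, y'', s''.
  case/and5P: dst => h1 h2 h3 h4 /andP [h5 _]; case/and5P: dia => k1 k2 k3 _ _.
  by rewrite /tri h1 h5 h4 k1 k3 k2 d6 dy dt dy'' ds'' U'.
case: (demandP sd') => [//|s' t' _ dy' ds' dst' st'|_ dy' ds' dt'
  |s' t' _ dy' ds' dt' dst' st'].
- rewrite ss' in dst'; case: (high _ _ _ dst' dy' ds').
  case: st => [] [? ?]; subst; case: st' => [] [? ?]; subst.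
  + exact: (V [:: 0; 1; 3; 4; 5]).
  + exact: (V [:: 0; 1; 3; 4; 6]).
  + exact: (V [:: 0; 1; 2; 4; 5]).
  + exact: (V [:: 0; 1; 2; 4; 6]).
- case: noD3; exists (src d), (tgt d), s, t, (tgt d'), (tgt (phi d')), (tgt (phi (rev d'))).
  rewrite /dia_cfg dst dia' /pred1 /= d6 dy ds dt dy' ds' dt' /=.
  case: st => [] [? ?]; subst; first exact: (V (iota 0 7)).
  exact: (V [:: 0; 1; 3; 2; 4; 5; 6]).
- rewrite ss' diamondC in dst'; case: (high _ _ _ dst' dy' dt').
  case: st => [] [? ?]; subst; case: st' => [] [? ?]; subst.
  + exact: (V [:: 0; 1; 3; 4; 6]).
  + exact: (V [:: 0; 1; 3; 4; 5]).
  + exact: (V [:: 0; 1; 2; 4; 6]).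
  + exact: (V [:: 0; 1; 2; 4; 5]).
Qed.

(** The fixed part is 76, leaving 20 for the two demands: [10 + 10] and [16 + 4] are the
    extremes. *)
Lemma heavy6_cost d : dg (src d) = 6 -> tface d -> tface (rho d) ->
  is_big (kind_of (iter 2 rho d)) -> tface (iter 3 rho d) -> tface (iter 4 rho d) ->
  is_big (kind_of (iter 5 rho d)) -> \sum_(i < 6) cost (iter i rho d) <= 96.
Proof.
move=> d6 t0 t1 b2 t3 t4 b5.
have nt x : is_big (kind_of x) -> ~~ tface x by rewrite -tface_kind; case: kind_of.
have cb x : is_big (kind_of x) -> cost x = 6.
  by move=> b; rewrite cost_ntface ?nt // /weight; case: kind_of b.
have sp : spine d by rewrite spine_rho t0 t1.
have sp' : spine (iter 3 rho d) by rewrite spine_rho t3 t4.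
have d06 : rho (iter 5 rho d) = d by have := iter_deg d; rewrite d6.
have U := @uniq_nbrs d 6; rewrite d6 in U; have {}U := U isT.
have s1 : tgt (phi d) = tgt (iter 5 rho d) by rewrite -{1}d06 tgt_phi_rho // d06.
have s2 : tgt (phi (rev d)) = tgt (rho d) by rewrite phi_drev.
have s1' : tgt (phi (iter 3 rho d)) = tgt (iter 2 rho d) by rewrite tgt_phi_rho.
have s2' : tgt (phi (rev (iter 3 rho d))) = tgt (iter 4 rho d) by rewrite phi_drev.
have h1 : spine_demand d = 16 -> spine_demand (iter 3 rho d) <= 4.
  apply: demand_deg6; rewrite ?src_iter_rho // s1 s2 s1' s2'.
  exact: (uniq_nth (src d) (idx := [:: 0; 1; 6; 2; 4; 3; 5]) U).
have h2 : spine_demand (iter 3 rho d) = 16 -> spine_demand d <= 4.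
  apply: demand_deg6; rewrite ?src_iter_rho // s1 s2 s1' s2'.
  exact: (uniq_nth (src d) (idx := [:: 0; 4; 3; 5; 1; 6; 2]) U).
have val x : spine x ->
    [\/ spine_demand x <= 4, spine_demand x = 10 | spine_demand x = 16].
  case/demandP => [|? ? -> _ _ _ _|-> _ _ _|? ? -> _ _ _ _ _];
  by [constructor 1|constructor 2|constructor 3].
have c0 : cost d = 16 + spine_demand d by rewrite cost_spine // d6.
have c1 : cost (rho d) = 16 by apply: cost_second => //; apply: nt b2.
have c3 : cost (iter 3 rho d) = 16 + spine_demand (iter 3 rho d).
  by rewrite cost_spine // src_iter_rho d6.
have c4 : cost (iter 4 rho d) = 16 by apply: cost_second => //; apply: nt b5.
have -> : \sum_(i < 6) cost (iter i rho d) = cost d + cost (rho d) + cost (iter 2 rho d)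
    + cost (iter 3 rho d) + cost (iter 4 rho d) + cost (iter 5 rho d).
  by rewrite !big_ord_recr big_ord0.
rewrite c0 c1 (cb _ b2) c3 c4 (cb _ b5).
move: (val _ sp) (val _ sp') h1 h2; move: (spine_demand d) (spine_demand (iter 3 rho d)).
by clear=> k1 k2 [] v1 [] v2 h1 h2; lia.
Qed.

Lemma vertex_cost v : \sum_(d | src d == v) cost d + 48 <= 24 * dg v.
Proof.
have [d0 sd0] : exists d, src d = v.
  have /card_gt0P [d] : 0 < #|[pred d | src d == v]|.
    by rewrite card_darts_at (leq_trans _ (mindeg v)).
  by rewrite inE => /eqP; exists d.
have m3 := mindeg v.
pose K i := kind_of (iter i rho d0).
have Kper i : K (dg v + i) = K i by rewrite /K addnC iterD -sd0 iter_deg.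
have sumv d : src d = v ->
    \sum_(d' | src d' == v) cost d' = \sum_(i < dg v) cost (iter i rho d).
  move=> sd; rewrite -sd -order_rho -sum_orbit.
  by apply: eq_bigl => d'; rewrite fconnect_rho.
have ok : kinds_ok (dg v) K.
  apply/and4P; split; apply/allP => i.
  - by move=> _; exact: kind_pair.
  - by move=> _; exact: kind_triple.
  - by move=> _; exact: kind_quintuple.
  rewrite mem_iota => /andP [_ lti]; rewrite glued_kind; apply/implyP => /glued_mate [j].
  rewrite src_iter_rho sd0 => j2 gj; apply/hasP; exists j; first by rewrite mem_iota; lia.
  by rewrite /K glued_kind addnC iterD.
case: (kinds_cost_bound m3 Kper ok) => [le| |].
- suff : \sum_(d | src d == v) cost d <= kinds_cost (dg v) K by lia.
  (* The sum starts two corners later because [corner_cost] bounds the middle one of its five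
     corners. *)
  rewrite (sumv (rho (rho d0))) ?src_rho // kinds_costE big_mkord.
  apply: leq_sum => i _; rewrite -iterSr -iterSr.
  by have := cost_corner (iter i rho d0); rewrite src_iter_rho sd0.
- case/andP=> /eqP d5 /hasP [i _ /and5P [t0 t1 b2 t3 b4]].
  rewrite (sumv (iter i rho d0)) ?src_iter_rho // d5.
  suff : \sum_(k < 5) cost (iter k rho (iter i rho d0)) <= 72 by lia.
  by apply: heavy5_cost; rewrite ?src_iter_rho ?sd0 -?tface_kind -?iterD.
- case/andP=> /eqP d6 /hasP [i _ /and5P [t0 t1 b2 t3 /andP [t4 b5]]].
  rewrite (sumv (iter i rho d0)) ?src_iter_rho // d6.
  suff : \sum_(k < 6) cost (iter k rho (iter i rho d0)) <= 96 by lia.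
  by apply: heavy6_cost; rewrite ?src_iter_rho ?sd0 -?tface_kind -?iterD.
Qed.

(** As no more is received than given, the total cost is at least the total weight, hence at least
    48 per face. *)
Lemma euler_deficit : 48 * #|T| + 48 * fcard phi predT <= 24 * #|{: dart e}|.
Proof.
have cdart : #|{: dart e}| = \sum_v dg v.
  rewrite -sum1_card (partition_big src predT) //=; apply: eq_bigr => v _.
  by rewrite -card_darts_at -sum1_card; apply: eq_bigl => d; rewrite inE.
have scost : \sum_d cost d + 48 * #|T| <= 24 * #|{: dart e}|.
  rewrite cdart (partition_big src predT) //= big_distrr /= -sum1_card big_distrr /=.
  by rewrite -big_split /=; apply: leq_sum => v _; rewrite muln1 vertex_cost.
have bal : \sum_d cost d + \sum_d get d = \sum_d weight d + \sum_d give d.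
  by rewrite -!big_split; apply: eq_bigr => d _; exact: costK.
have := faces_weight; have := sum_get_give; lia.
Qed.


End Embedding.

(** * Contradiction with Euler's formula *)

Theorem mainTheorem8 (T : finType) (e : rel T) :
  simple_graph e -> planar e -> 0 < #|T| ->
  ~ has_K4 e -> ~ has_cycle e 5 -> ~ has_cycle e 6 -> ~ has_cycle e 7 ->
  D1 e \/ D2 e \/ D3 e \/ D4 e \/ D5 e \/ D6 e \/ D7 e \/ D8 e \/ D9 e \/
  D10 e \/ D11 e \/ D12 e.
Proof.
move=> [e_sym e_irr] [rho [rot euler]] T0 noK4 noC5 noC6 noC7.
apply: NNPP => noD; have noD1 : ~ D1 e by tauto.
have mindeg v : 2 < deg e v.
  by rewrite ltnNge; apply/negP => ?; apply: noD1; exists v.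
have iso0 : #|[pred x | isolated e x]| = 0.
  by apply: eq_card0 => x; rewrite !inE /isolated; have := mindeg x; case: (deg e x).
have ncomp : 0 < n_comp e predT.
  have [x _] := card_gt0P T0; apply/card_gt0P; exists (root e x).
  by rewrite !inE andbT; apply: roots_root; apply: sym_connect_sym.
(* Without isolated vertices and with at least one component, 24 times Euler's formula makes the
   left side exceed the right side by at least 96. *)
suff : 48 * #|T| + 48 * fcard (face_perm rho) predT <= 24 * #|{: dart e}| by lia.
by apply: euler_deficit => //; tauto.
Qed.
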